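(* Let $G$ be a totally disconnected locally compact group, $\phi:G\to G$ a topological automorphism and $U\in\mathcal B(G)$. Then $$H_{top}(\phi,U)=\log[\phi(C(\phi^{-1},U)):C(\phi^{-1},U)].$$
   Context: For a totally disconnected locally compact group $G$, $\mathcal B(G)$ denotes the family of all open compact subgroups of $G$ (a local base at $1$ by van Dantzig's theorem). A topological automorphism is a group automorphism that is a homeomorphism. For a continuous endomorphism $\psi:G\to G$, $U\in\mathcal B(G)$ and an integer $n\ge 1$, put $$C_n(\psi,U)=U\cap\psi^{-1}(U)\cap\ldots\cap\psi^{-n+1}(U),\qquad C(\psi,U)=\bigcap_{n=0}^\infty\psi^{-n}(U)=\bigcap_{n=1}^\infty C_n(\psi,U).$$ Thus, for a topological automorphism $\phi$, $C(\phi^{-1},U)=\bigcap_{n\ge 0}\phi^n(U)$, and $C(\phi^{-1},U)\subseteq \phi(C(\phi^{-1},U))$. The index $[U:C_n(\psi,U)]$ is finite. The topological entropy of $\psi$ with respect to $U$ is $$H_{top}(\psi,U)=\lim_{n\to\infty}\frac{\log[U:C_n(\psi,U)]}{n}$$ (the limit exists). $[K:H]$ denotes the index of a subgroup $H$ in a group $K$. *)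

(* Defs.v *)
From HB Require Import structures.
From mathcomp Require Import all_boot all_order all_algebra.
From mathcomp Require Import all_classical all_reals all_analysis.

Set Implicit Arguments.
Unset Strict Implicit.
Unset Printing Implicit Defensive.

Import Order.TTheory GRing.Theory Num.Theory.
Import numFieldNormedType.Exports.

Local Open Scope classical_set_scope.

HB.mixin Record isTopologicalGroup G & Topological G & Group G := {
  mulg_continuous : continuous (fun x : G * G => (x.1 * x.2)%g);
  invg_continuous : continuous (fun x : G => x^-1%g)
}.

#[short(type="topologicalGroupType")]
HB.structure Definition TopologicalGroup :=
  {G of Topological G & Group G & isTopologicalGroup G}.

(* Hausdorffness is not required separately: in a totally disconnected group  *)
(* points are closed, and a topological group with closed points is           *)
(* Hausdorff.                                                                 *)
Definition tdlc (G : topologicalGroupType) :=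
  totally_disconnected [set: G] /\ locally_compact [set: G].

Definition subgroup (G : groupType) (H : set G) :=
  H 1%g /\ forall x y, H x -> H y -> H (x / y)%g.

Definition open_compact_subgroup (G : topologicalGroupType) : set (set G) :=
  [set U | [/\ subgroup U, open U & compact U]].

(* phi is a topological automorphism and phiV is the inverse function         *)
Definition topological_automorphism (G : topologicalGroupType)
    (phi phiV : G -> G) :=
  [/\ {morph phi : x y / (x * y)%g}, cancel phi phiV, cancel phiV phi,
      continuous phi & continuous phiV].

Definition left_cosets (G : groupType) (K H : set G) : set (set G) :=
  [set [set (g * h)%g | h in H] | g in K].

(* [K : H], equal to +oo when there are infinitely many cosets                *)
Definition group_index (R : realType) (G : groupType) (K H : set G) : \bar R :=
  counting (left_cosets K H).

(* C_n(psi, U) for n >= 1; the value at n = 0 is setT                          *)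
Definition Cn (T : Type) (psi : T -> T) (U : set T) (n : nat) : set T :=
  \bigcap_(i in `I_n) (iter i psi @^-1` U).

Definition Cinf (T : Type) (psi : T -> T) (U : set T) : set T :=
  \bigcap_i (iter i psi @^-1` U).

(* the term at n = 0 is meaningless and does not affect the limit             *)
Definition Htop_seq (R : realType) (G : groupType) (psi : G -> G) (U : set G) :
    nat -> \bar R :=
  fun n => (lne (group_index R U (Cn psi U n)) / n%:R%:E)%E.

Definition Htop (R : realType) (G : groupType) (psi : G -> G) (U : set G) :
    \bar R :=
  limn (Htop_seq R psi U).

(* Main.v *)
Require Import Defs.
From HB Require Import structures.
From mathcomp Require Import all_boot all_order all_algebra.
From mathcomp Require Import all_classical all_reals all_analysis.
From mathcomp Require Import zify ring.

Set Implicit Arguments.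
Unset Strict Implicit.
Unset Printing Implicit Defensive.

Import Order.TTheory GRing.Theory Num.Theory.
Import numFieldNormedType.Exports.

Local Open Scope classical_set_scope.

(** Write [U_n] for [Cn phi U n], [V_n] for [Cn phiV U n] and [C] for
    [Cinf phiV U], the intersection of the decreasing sequence [V_n].

    The indices [[U : U_n]] form, from some point on, an exact geometric
    progression whose ratio is the index [[phi C : C]]; the limit defining the
    entropy is then immediate.

    By the tower formula, [[U : U_(n+1)] = [U : U_n] * [U_n : U_(n+1)]] for
    [n >= 1].  The automorphism [phi^n] carries [U_n] onto [phi V_n] and
    [U_(n+1)] onto [V_(n+1)], which is the intersection of [phi V_n] and [U].
    Hence [[U_n : U_(n+1)]] is the number of left cosets of [U] that meet
    [phi V_n] ([left_cosets_CnS]).  In the same way [C] is the intersection of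
    [phi C] and [U], so [[phi C : C]] is the number of left cosets of [U] that
    meet [phi C].

    The compact sets [phi V_n] decrease to [phi C], and the union of the cosets
    of [U] meeting [phi C] is open.  By compactness this union contains
    [phi V_n] for all large [n]; so for these [n] the cosets of [U] meeting
    [phi V_n] are exactly those meeting [phi C] ([near_left_cosets_stable]), and
    each further step multiplies the index by [[phi C : C]]
    ([index_Cn_geometric]). *)

(** * Left cosets and indices *)

Section left_cosets_theory.
Variable G : groupType.
Implicit Types (g x : G) (H K L U : set G).

Definition translate g H : set G := [set (g * h)%g | h in H].

Lemma translateP g H x : translate g H x <-> H (g^-1 * x)%g.
Proof.
split=> [[h Hh <-]|Hx]; first by rewrite mulgA mulVg mul1g.
by exists (g^-1 * x)%g => //; rewrite mulgA mulgV mul1g.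
Qed.

Lemma subgroupV H x : subgroup H -> H x -> H (x^-1)%g.
Proof. by move=> [H1 Hdiv] Hx; have := Hdiv _ _ H1 Hx; rewrite mul1g. Qed.

Lemma subgroupM H x y : subgroup H -> H x -> H y -> H (x * y)%g.
Proof.
move=> sH Hx Hy; rewrite -[y]invgK; apply: sH.2 => //; exact: subgroupV.
Qed.

Lemma translate_refl g H : subgroup H -> translate g H g.
Proof. by move=> sH; apply/translateP; rewrite mulVg; exact: sH.1. Qed.

Lemma translate_eqP g g' H : subgroup H ->
  translate g H = translate g' H <-> H (g^-1 * g')%g.
Proof.
move=> sH; split=> [eqH|Hgg'].
  by apply/translateP; rewrite eqH; exact: translate_refl.
have Hg'g : H (g'^-1 * g)%g.
  by have := subgroupV sH Hgg'; rewrite invgM invgK.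
apply/seteqP; split=> x /translateP Hx; apply/translateP.
  by have := subgroupM sH Hg'g Hx; rewrite !mulgA mulgK.
by have := subgroupM sH Hgg' Hx; rewrite !mulgA mulgK.
Qed.

(** The tower formula [[K : L] = [K : H] * [H : L]], without finiteness: once a
    representative [rep X] of each left coset [X] of [H] is chosen, every left
    coset of [L] in [K] is [rep X * Y] for exactly one [X] and one left coset
    [Y] of [L] in [H]. *)
Lemma left_cosets_tower K H L : subgroup K -> subgroup H -> subgroup L ->
  L `<=` H -> H `<=` K ->
  (left_cosets K L #= left_cosets K H `*` left_cosets H L)%card.
Proof.
move=> sK sH sL LH HK.
pose rep X := xget 1%g [set g | K g /\ translate g H = X].
have repP X : left_cosets K H X -> K (rep X) /\ translate (rep X) H = X.
  move=> [g Kg gX]; rewrite /rep.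
  by case: xgetP => [y _ //|/(_ g)]; case; split.
pose glue (XY : set G * set G) := translate (rep XY.1) XY.2.
have glueE X h : glue (X, translate h L) = translate (rep X * h)%g L.
  rewrite /glue /=; apply/seteqP; split=> [_ [_ [l Ll <-] <-]|_ [l Ll <-]].
    by exists l => //; rewrite mulgA.
  by exists (h * l)%g; [exists l|rewrite mulgA].
have -> : left_cosets K L = glue @` (left_cosets K H `*` left_cosets H L).
  apply/seteqP; split=> [_ [g Kg <-]|_ [[X _] [/= KX [h Hh <-]] <-]].
    have KHg : left_cosets K H (translate g H) by exists g.
    have [Kr /(translate_eqP _ _ sH) Hr] := repP _ KHg.
    exists (translate g H, translate ((rep (translate g H))^-1 * g)%g L).
      by split=> //; exists ((rep (translate g H))^-1 * g)%g.
    by rewrite glueE mulgA mulgV mul1g.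
  have [Kr _] := repP _ KX.
  rewrite -[X in glue (_, X)]/(translate h L) glueE.
  by exists (rep X * h)%g => //; apply: subgroupM => //; exact: HK.
apply: inj_card_eq => -[X Y] [X' Y'] /set_mem[/= KX [h Hh <-]].
move=> /set_mem[/= KX' [h' Hh' <-]].
rewrite -[X in glue (_, X)]/(translate h L).
rewrite -[X in _ = glue (_, X)]/(translate h' L) !glueE => eqL.
have XX' : X = X'.
  rewrite -(repP _ KX).2 -(repP _ KX').2; apply/(translate_eqP _ _ sH).
  move/(translate_eqP _ _ sL)/LH : eqL => Hrr.
  have := subgroupM sH (subgroupM sH Hh Hrr) (subgroupV sH Hh').
  by rewrite invgM !mulgA mulgV mul1g mulgK.
congr pair => //; apply/(translate_eqP _ _ sL).
move/(translate_eqP _ _ sL): eqL.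
by rewrite XX' invgM !mulgA mulgVK.
Qed.

(** Both sides count the left cosets of [U] that meet [H].  Since [left_cosets]
    makes sense even if [U] is not contained in [H], the intersection can be
    traded for [U], which no longer varies with [H]; the right-hand side thus
    grows with [H]. *)
Lemma left_cosets_setI H U : subgroup H -> subgroup U ->
  (left_cosets H (H `&` U) #= left_cosets H U)%card.
Proof.
move=> sH sU.
have sHU : subgroup (H `&` U).
  split=> [|x y [Hx Ux] [Hy Uy]]; first by split; [exact: sH.1|exact: sU.1].
  by split; [exact: sH.2|exact: sU.2].
pose mulU (X : set G) := [set (x * u)%g | x in X & u in U].
have mulUE h : mulU (translate h (H `&` U)) = translate h U.
  apply/seteqP; split=> [_ [_ [k [_ Uk] <-] [u Uu <-]]|_ [u Uu <-]].
    by exists (k * u)%g; [exact: subgroupM|rewrite mulgA].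
  by exists h; [exact: translate_refl|exists u].
have -> : left_cosets H U = mulU @` left_cosets H (H `&` U).
  apply/seteqP; split=> [_ [h Hh <-]|_ [_ [h Hh <-] <-]].
    by exists (translate h (H `&` U)); [exists h|rewrite mulUE].
  by exists h => //; rewrite -[LHS]/(translate h U) -mulUE.
rewrite card_eq_sym; apply: inj_card_eq => X Y /set_mem[h Hh <-].
move=> /set_mem[k Hk <-].
rewrite -![[set _ | _ in _]]/(translate _ (H `&` U)) !mulUE.
move=> /(translate_eqP _ _ sU) Uhk; apply/(translate_eqP _ _ sHU); split=> //.
by apply: subgroupM => //; exact: subgroupV.
Qed.

Lemma left_cosets_image (f : G -> G) K H :
  {morph f : x y / (x * y)%g} -> injective f ->
  (left_cosets (f @` K) (f @` H) #= left_cosets K H)%card.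
Proof.
move=> fM finj.
have fE g : translate (f g) (f @` H) = f @` translate g H.
  apply/seteqP; split=> [_ [_ [h Hh <-] <-]|_ [_ [h Hh <-] <-]].
    by exists (g * h)%g; [exists h|rewrite fM].
  by exists (f h); [exists h|rewrite fM].
have -> : left_cosets (f @` K) (f @` H) = (image^~ f) @` left_cosets K H.
  apply/seteqP; split=> [_ [_ [g Kg <-] <-]|_ [_ [g Kg <-] <-]].
    by exists (translate g H); [exists g|rewrite -fE].
  by exists (f g); [exists g|rewrite -[LHS]/(translate _ _) fE].
apply: inj_card_eq => X Y _ _ eqXY.
by apply/seteqP; split=> x Xx;
  [have : (f @` Y) (f x) by rewrite -eqXY; exists x
  |have : (f @` X) (f x) by rewrite eqXY; exists x]; case=> y ? /finj <-.
Qed.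

Lemma left_cosetsS K K' H : K `<=` K' -> left_cosets K H `<=` left_cosets K' H.
Proof. by move=> KK' _ [g /KK' Kg <-]; exists g. Qed.

Lemma left_cosets_gt0 K H n : subgroup K ->
  (left_cosets K H #= `I_n)%card -> (0 < n)%N.
Proof.
move=> sK; case: n => //; rewrite II0 card_eq0 => /eqP K0.
suff : left_cosets K H (translate 1%g H) by rewrite K0.
by exists 1%g => //; exact: sK.1.
Qed.

Lemma morph_one (f : G -> G) : {morph f : x y / (x * y)%g} -> f 1%g = 1%g.
Proof. by move=> fM; apply: (@mulgI _ (f 1%g)); rewrite -fM !mulg1. Qed.

Lemma morph_div (f : G -> G) : {morph f : x y / (x * y)%g} ->
  {morph f : x y / (x / y)%g}.
Proof.
move=> fM x y; rewrite fM; congr (_ * _)%g; apply: (@mulgI _ (f y)).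
by rewrite -fM !mulgV morph_one.
Qed.

Lemma iter_morph (f : G -> G) n : {morph f : x y / (x * y)%g} ->
  {morph iter n f : x y / (x * y)%g}.
Proof. by move=> fM; elim: n => [//|n IHn] x y; rewrite !iterS IHn fM. Qed.

Lemma subgroup_image (f : G -> G) H : {morph f : x y / (x * y)%g} ->
  subgroup H -> subgroup (f @` H).
Proof.
move=> fM sH; split=> [|_ _ [x Hx <-] [y Hy <-]].
  by exists 1%g; [exact: sH.1|exact: morph_one].
by exists (x / y)%g; [exact: sH.2|exact: morph_div].
Qed.

Lemma subgroup_bigcap_preimage I (D : set I) (f : I -> G -> G) U :
  (forall i, {morph f i : x y / (x * y)%g}) -> subgroup U ->
  subgroup (\bigcap_(i in D) (f i @^-1` U)).
Proof.
move=> fM sU; split=> [i _|x y Dx Dy i Di] /=.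
  by rewrite morph_one//; exact: sU.1.
by rewrite morph_div//; apply: sU.2; [exact: Dx|exact: Dy].
Qed.

End left_cosets_theory.

Lemma group_indexE (R : realType) (G : groupType) (K H : set G) n :
  (left_cosets K H #= `I_n)%card -> group_index R K H = (n%:R)%:E.
Proof.
move=> Kn.
have fin : finite_set (left_cosets K H) by apply/finite_setP; exists n.
by rewrite /group_index /counting asboolT// (card_fset_set Kn).
Qed.

(** Euclidean division by [n] identifies [`I_m `*` `I_n] with [`I_(m * n)]. *)
Lemma card_setX_II S T (A : set S) (B : set T) m n :
  (A #= `I_m)%card -> (B #= `I_n)%card -> (A `*` B #= `I_(m * n))%card.
Proof.
move=> /card_set_bijP[f [fm finj fsurj]] /card_set_bijP[g [gn ginj gsurj]].
pose h (xy : S * T) := (f xy.1 * n + g xy.2)%N.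
have -> : `I_(m * n) = h @` (A `*` B).
  apply/seteqP; split=> [k /= kmn|_ [[x y] [/= Ax By] <-]]; last first.
    by have := fm _ Ax; have := gn _ By; rewrite /h /=; nia.
  have n0 : (0 < n)%N by nia.
  have [x Ax fx] : (f @` A) (k %/ n)%N by apply: fsurj; rewrite /= ltn_divLR.
  have [y By gy] : (g @` B) (k %% n)%N by apply: gsurj; rewrite /= ltn_mod.
  by exists (x, y) => //; rewrite /h /= fx gy -divn_eq.
rewrite card_eq_sym; apply: inj_card_eq => -[x y] [x' y'].
move=> /set_mem[/= Ax By] /set_mem[/= Ax' By'] /(congr1 (edivn^~ n)).
rewrite !edivn_eq ?(gn _ By) ?(gn _ By')//= => -[fxx' gyy'].
by congr pair; [apply: finj|apply: ginj] => //; exact: mem_set.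
Qed.

(** * Cosets of open subgroups and compactness *)

Section topological_cosets.
Variable G : topologicalGroupType.
Implicit Types (K O U : set G).

Lemma continuous_translate (g : G) : continuous (fun x : G => (g * x)%g).
Proof.
move=> x; apply: (@continuous_comp _ _ _ (fun y : G => (g, y))
  (fun z : G * G => (z.1 * z.2)%g)); last exact: mulg_continuous.
by apply: cvg_pair; [exact: cvg_cst|exact: cvg_id].
Qed.

Lemma open_translate g U : open U -> open (translate g U).
Proof.
move=> oU; rewrite (_ : translate g U = (fun x => (g^-1 * x)%g) @^-1` U).
  by apply: open_comp => // x _; exact: continuous_translate.
by apply/seteqP; split=> x /translateP.
Qed.

(** The complement of an open subgroup is a union of cosets, hence open. *)
Lemma open_subgroup_closed U : subgroup U -> open U -> closed U.
Proof.
move=> sU oU; rewrite -(setCK U); apply: open_closedC.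
rewrite (_ : ~` U = \bigcup_(g in ~` U) translate g U).
  by apply: bigcup_open => g _; exact: open_translate.
apply/seteqP; split=> [x Ux|x [g Ug /translateP gx] Ux].
  by exists x => //; exact: translate_refl.
by apply: Ug; have := subgroupM sU Ux (subgroupV sU gx);
  rewrite invgM invgK mulVKg.
Qed.

(** The left cosets of [U] cover [K], and finitely many of them suffice; since
    cosets are equal or disjoint, no others meet [K]. *)
Lemma finite_left_cosets K U : compact K -> subgroup U -> open U ->
  finite_set (left_cosets K U).
Proof.
move=> /compact_near_coveringP cK sU oU.
(* Finite sets of representatives, directed by inclusion: membership of a given
   point in the cosets they represent holds eventually along this filter. *)
pose F := filter_from [set D : set G | finite_set D]
  (fun D => [set E | finite_set E /\ D `<=` E]).
have FF : Filter F.
  apply: filter_from_filter; first by exists set0; exact: finite_set0.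
  move=> D D' fD fD'; exists (D `|` D'); first by rewrite /= finite_setU.
  by move=> E [fE]; rewrite subUset => -[DE D'E].
have [x Kx|D fD KD] := cK _ F (fun E x => exists2 g, E g & translate g U x) FF.
  near=> y E; exists x.
    by near: E; exists [set x]; [exact: finite_set1|move=> E [_]; exact].
  near: y; apply: open_nbhs_nbhs; split; first exact: open_translate.
  exact: translate_refl.
apply: (@sub_finite_set _ _ ((fun g => translate g U) @` D)); last first.
  exact: finite_image.
move=> _ [x Kx <-].
have [g Dg /translateP gx] := KD D (conj fD (@subset_refl _ D)) x Kx.
by exists g => //; apply/(translate_eqP _ _ sU).
Unshelve. all: by end_near. Qed.

End topological_cosets.

(** A point of [K] outside [O] is missed, together with a neighbourhood, by all
    [F n] with [n] large; compactness of [K] makes the bound on [n] uniform. *)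
Lemma compact_bigcap_sub_open (T : topologicalType) (K O : set T)
    (F : nat -> set T) :
  compact K -> open O -> (forall n, closed (F n)) ->
  (forall m n, (m <= n)%N -> F n `<=` F m) ->
  K `&` \bigcap_n F n `<=` O -> \forall n \near \oo, K `&` F n `<=` O.
Proof.
move=> /compact_near_coveringP cK oO clF decF KFO.
have := cK nat \oo (fun n x => F n x -> O x) _.
case=> [x Kx|N _ NKO]; last by exists N => // n Nn x [Kx]; exact: NKO.
have [Ox|nOx] := pselect (O x).
  near=> y n; suff : O y by [].
  by near: y; apply: open_nbhs_nbhs; split.
have /existsNP[m Fmx] : ~ forall m, F m x.
  by move=> Fx; apply: nOx; apply: KFO; split=> // m _.
near=> y n.
have nFmy : (~` F m) y.
  by near: y; apply: open_nbhs_nbhs; split => //; exact: closed_openC.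
have mn : (m <= n)%N by near: n; exists m.
by move=> /(decF _ _ mn).
Unshelve. all: by end_near. Qed.

(** * Growth rate of a geometric progression *)

Lemma cvg_log_geometric (R : realType) (a c N : nat) :
  (0 < a)%N -> (0 < c)%N ->
  (fun n => lne (c * a ^ (n - N))%:R%:E / n%:R%:E)%E @ \oo -->
  (lne a%:R%:E : \bar R).
Proof.
move=> a0 c0.
have a0R : (0 < a%:R :> R)%R by rewrite ltr0n.
have c0R : (0 < c%:R :> R)%R by rewrite ltr0n.
pose b : R := (ln c%:R - ln a%:R *+ N)%R.
pose v n : R := (ln a%:R + b * n%:R^-1)%R.
have -> : lne a%:R%:E = (ln a%:R : R)%:E by rewrite lne_EFin.
(* The normalised logarithm is [ln a + b / n] exactly, once [n > N]. *)
have vE : \forall n \near \oo,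
    (v n)%:E = (lne (c * a ^ (n - N))%:R%:E / n%:R%:E)%E.
  exists N.+1 => // n Nn.
  have {}Nn : (N < n)%N := Nn.
  have n0 : (n%:R != 0 :> R)%R by rewrite pnatr_eq0; lia.
  rewrite lne_EFin ?ltr0n ?muln_gt0 ?expn_gt0 ?c0 ?a0//.
  rewrite natrM natrX lnM ?posrE ?exprn_gt0// lnXn// inver (negPf n0) -EFinM.
  congr EFin; rewrite /v /b -(mulr_natr _ (n - N)) natrB ?(ltnW Nn)//.
  by rewrite -mulr_natr; field.
apply: cvg_trans (near_eq_cvg vE) _.
apply: cvg_EFin; first exact: nearW.
rewrite -[X in _ --> X]addr0; apply: cvgD; first exact: cvg_cst.
rewrite -[X in _ --> X](mulr0 b); apply: cvgM; first exact: cvg_cst.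
by rewrite -cvg_shiftS; exact: cvg_harmonic.
Qed.

(** * Trajectories of an open compact subgroup *)

Section trajectories.
Variables (T : Type) (psi : T -> T) (U : set T).

Lemma iter_cancel (psiV : T -> T) i n x : cancel psi psiV ->
  (i <= n)%N -> iter i psiV (iter n psi x) = iter (n - i) psi x.
Proof.
move=> psiK /subnKC {1}<-; rewrite iterD; move: (iter (n - i) psi x) => y.
by elim: i => [//|i IHi]; rewrite iterSr iterS psiK.
Qed.

Lemma CnS n : Cn psi U n.+1 = U `&` psi @^-1` Cn psi U n.
Proof.
apply/seteqP; split=> [x Cx|x [Ux Cx] [|i] /=]//.
  by split=> [|i /= ni]; [exact: (Cx 0%N)|rewrite -iterSr; exact: Cx].
by move=> ni; rewrite -iterS iterSr; exact: Cx.
Qed.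

Lemma CinfE : Cinf psi U = U `&` psi @^-1` Cinf psi U.
Proof.
apply/seteqP; split=> [x Cx|x [Ux Cx] [|i] /=]//.
  by split=> [|i /= ni]; [exact: (Cx 0%N)|rewrite /= -iterSr; exact: Cx].
by move=> ni; rewrite -iterS iterSr; exact: Cx.
Qed.

Lemma Cn_nonincreasing m n : (m <= n)%N -> Cn psi U n `<=` Cn psi U m.
Proof. by move=> mn x Cx i /= im; apply: Cx => /=; lia. Qed.

Lemma Cn_sub n : Cn psi U n.+1 `<=` U.
Proof. by rewrite CnS; exact: subIsetl. Qed.

Lemma Cn1 : Cn psi U 1 = U.
Proof. by apply/seteqP; split=> [x /(_ 0%N)|x Ux [|i]]//; exact. Qed.

End trajectories.

Lemma subgroup_Cn (G : groupType) (psi : G -> G) (U : set G) n :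
  {morph psi : x y / (x * y)%g} -> subgroup U -> subgroup (Cn psi U n).
Proof.
by move=> psiM; apply: subgroup_bigcap_preimage => i; exact: iter_morph.
Qed.

Lemma subgroup_Cinf (G : groupType) (psi : G -> G) (U : set G) :
  {morph psi : x y / (x * y)%g} -> subgroup U -> subgroup (Cinf psi U).
Proof.
by move=> psiM; apply: subgroup_bigcap_preimage => i; exact: iter_morph.
Qed.

Lemma continuous_iter (T : topologicalType) (f : T -> T) n :
  continuous f -> continuous (iter n f).
Proof.
move=> cf; elim: n => [|n IHn] x /=; first exact: cvg_id.
by apply: continuous_comp; [exact: IHn|exact: cf].
Qed.

Section automorphism.
Variables (G : topologicalGroupType) (phi phiV : G -> G) (U : set G).
Hypothesis aut : topological_automorphism phi phiV.
Hypothesis ocU : open_compact_subgroup U.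

Let phiM : {morph phi : x y / (x * y)%g}. Proof. by case: aut. Qed.
Let phiK : cancel phi phiV. Proof. by case: aut. Qed.
Let phiVK : cancel phiV phi. Proof. by case: aut. Qed.
Let sU : subgroup U. Proof. by case: ocU. Qed.
Let oU : open U. Proof. by case: ocU. Qed.

Let phiVM : {morph phiV : x y / (x * y)%g}.
Proof. by move=> x y; apply: (can_inj phiK); rewrite phiM !phiVK. Qed.

Let compact_phiU : compact (phi @` U).
Proof.
apply: continuous_compact; last by case: ocU.
by apply: continuous_subspaceT; case: aut.
Qed.

Lemma image_preimageV (A : set G) : phi @` A = phiV @^-1` A.
Proof.
apply/seteqP; split=> [_ [x Ax <-]|x Ax]; first by rewrite /= phiK.
by exists (phiV x).
Qed.

(** The automorphism [phi^n] carries [phi^(-i) U] to [phi^(n-i) U], so it turns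
    the backward translates that are intersected into the forward ones, in
    reverse order. *)
Lemma iter_image_Cn n : iter n phi @` Cn phi U n.+1 = Cn phiV U n.+1.
Proof.
apply/seteqP; split=> [_ [x Cx <-] i /= ni|y Cy].
  by rewrite iter_cancel//; apply: Cx => /=; lia.
exists (iter n phiV y) => [i /= ni|]; last by rewrite iter_cancel// subnn.
by rewrite iter_cancel//; apply: Cy => /=; lia.
Qed.

Lemma CnV_setI n : Cn phiV U n.+1 = phi @` Cn phiV U n `&` U.
Proof. by rewrite image_preimageV setIC -CnS. Qed.

Lemma CinfV_setI : Cinf phiV U = phi @` Cinf phiV U `&` U.
Proof. by rewrite image_preimageV setIC -CinfE. Qed.

(** Applying [phi^(n+1)] turns [[U_(n+1) : U_(n+2)]] into the number of cosets
    of [U] meeting [phi V_(n+1)].  The index starts at [n+1] because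
    [Cn phi U 0] is the whole group rather than a subgroup of [U]. *)
Lemma left_cosets_CnS n c a :
  (left_cosets U (Cn phi U n.+1) #= `I_c)%card ->
  (left_cosets (phi @` Cn phiV U n.+1) U #= `I_a)%card ->
  (left_cosets U (Cn phi U n.+2) #= `I_(c * a))%card.
Proof.
move=> cUn aVn; have sC k := subgroup_Cn k phiM sU.
have UnS : Cn phi U n.+2 `<=` Cn phi U n.+1 by exact: Cn_nonincreasing.
have UnU : Cn phi U n.+1 `<=` U by exact: Cn_sub.
apply: card_eq_trans (left_cosets_tower sU (sC _) (sC _) UnS UnU) _.
apply: card_setX_II cUn _.
have phin_inj : injective (iter n.+1 phi).
  by elim: n.+1 => [//|k IHk] x y; rewrite !iterS => /(can_inj phiK)/IHk.
have := left_cosets_image (Cn phi U n.+1) (Cn phi U n.+2)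
  (iter_morph n.+1 phiM) phin_inj.
rewrite iter_image_Cn CnV_setI.
have -> : iter n.+1 phi @` Cn phi U n.+1 = phi @` Cn phiV U n.+1.
  by rewrite -iter_image_Cn image_comp.
rewrite card_eq_sym => /card_eq_trans; apply.
apply: card_eq_trans aVn; apply: left_cosets_setI => //.
by apply: subgroup_image => //; exact: subgroup_Cn.
Qed.

(** The open set to which compactness applies is the union of the cosets of [U]
    meeting [phi C]: it contains the intersection [phi C] of the [phi V_n],
    hence [phi V_n] itself for [n] large. *)
Lemma near_left_cosets_stable : \forall n \near \oo,
  left_cosets (phi @` Cn phiV U n) U = left_cosets (phi @` Cinf phiV U) U.
Proof.
have cV : continuous phiV by case: aut.
have clU := open_subgroup_closed sU oU.
have := @compact_bigcap_sub_open _ _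
  (\bigcup_(g in phi @` Cinf phiV U) translate g U)
  (fun n => phi @` Cn phiV U n) compact_phiU.
case.
- by apply: bigcup_open => g _; exact: open_translate.
- move=> n; rewrite image_preimageV; apply: preimage_closed => //.
  apply: closed_bigI => i _; apply: preimage_closed => //.
  by move=> x _; exact: continuous_iter.
- by move=> m n mn; apply: image_subset; exact: Cn_nonincreasing.
- move=> x [_ Cx]; exists x; last exact: translate_refl.
  rewrite image_preimageV => i _.
  by move: (Cx i.+1 I); rewrite image_preimageV; apply => /=.
move=> N _ HN; exists N.+1 => // -[//|n] /= Nn.
apply/seteqP; split; last first.
  by apply: left_cosetsS; apply: image_subset => x Cx i _; exact: Cx.
move=> _ [x Cx <-].
have [|g Cg /translateP gx] := HN n.+1 (ltnW Nn) x.
  by split=> //; move: Cx; apply: image_subset; exact: Cn_sub.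
by exists g => //; apply/(translate_eqP _ _ sU).
Qed.

Lemma finite_left_cosets_phi n :
  finite_set (left_cosets (phi @` Cn phiV U n.+1) U).
Proof.
apply: (@sub_finite_set _ _ (left_cosets (phi @` U) U)).
  by apply: left_cosetsS; apply: image_subset; exact: Cn_sub.
exact: finite_left_cosets.
Qed.

Lemma finite_left_cosets_Cn n :
  exists c, (left_cosets U (Cn phi U n.+1) #= `I_c)%card.
Proof.
elim: n => [|n [c cn]].
  apply/finite_setP; rewrite Cn1; apply: finite_left_cosets => //.
  by case: ocU.
have /finite_setP[a an] := finite_left_cosets_phi n.
by exists (c * a)%N; exact: left_cosets_CnS.
Qed.

(** The progression starts where the cosets of [U] meeting [phi V_n] have become
    stable; the ratio [a] is their number, which is also [[phi C : C]]. *)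
Lemma index_Cn_geometric : exists a c N,
  [/\ (0 < a)%N, (0 < c)%N,
    (left_cosets (phi @` Cinf phiV U) (Cinf phiV U) #= `I_a)%card &
    forall m, (left_cosets U (Cn phi U (N + m)) #= `I_(c * a ^ m))%card].
Proof.
have sphiC : subgroup (phi @` Cinf phiV U).
  by apply: subgroup_image => //; exact: subgroup_Cinf.
have [N _ stableN] := near_left_cosets_stable.
have stable m : left_cosets (phi @` Cn phiV U (N + m).+1) U =
                left_cosets (phi @` Cinf phiV U) U.
  by apply: stableN => /=; lia.
have [a aC] : exists a, (left_cosets (phi @` Cinf phiV U) U #= `I_a)%card.
  by apply/finite_setP; rewrite -(stable 0%N); exact: finite_left_cosets_phi.
have [c cN] := finite_left_cosets_Cn N.
exists a, c, N.+1; split.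
- exact: left_cosets_gt0 aC.
- exact: left_cosets_gt0 cN.
- rewrite {2}CinfV_setI.
  by apply: card_eq_trans aC; exact: left_cosets_setI.
elim=> [|m IHm]; first by rewrite addn0 expn0 muln1.
rewrite addnS expnSr mulnA; apply: left_cosets_CnS => //.
by rewrite stable.
Qed.

End automorphism.

Theorem theorem2p4 (R : realType) (G : topologicalGroupType) (phi phiV : G -> G)
    (U : set G) :
  tdlc G -> topological_automorphism phi phiV -> open_compact_subgroup U ->
  cvgn (Htop_seq R phi U) /\
  Htop R phi U = lne (group_index R (phi @` Cinf phiV U) (Cinf phiV U)).
Proof.
move=> _ aut ocU.
have [a [c [N [a0 c0 aC cC]]]] := index_Cn_geometric aut ocU.
have lim : Htop_seq R phi U n @[n --> \oo] -->
    lne (group_index R (phi @` Cinf phiV U) (Cinf phiV U)).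
  rewrite (group_indexE R aC).
  apply: cvg_trans _ (cvg_log_geometric N a0 c0).
  apply: near_eq_cvg; exists N => // n Nn.
  rewrite /Htop_seq (group_indexE R (n := (c * a ^ (n - N))%N))//.
  by have := cC (n - N)%N; rewrite subnKC.
by split; [exact: cvgP lim|exact: cvg_lim lim].
Qed.
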